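(* Let $n,k$ be integers with $1<k<n$. Then the function $\psi=\psi(n,k)$ defined by $$\psi(z)=\frac{1}{2\pi i}\int_{|w|=1}w^{k-2}\exp\left\{\frac{z}{w}-\frac{1}{(n-k+1)w^{n-k+1}}-\frac{w^{k-1}}{k-1}\right\}dw$$ is a transcendental solution $f=\psi(z)$ of the differential equation $$f^{(n)}-zf^{(k)}-f=0.$$
   Context: The circle $|w|=1$ is traversed once counterclockwise. Solutions are entire functions of $z\in\mathbb{C}$; an entire function is transcendental if it is not a polynomial. *)

(* Defs.v *)
From Stdlib Require Export Reals.
From Coquelicot Require Export Coquelicot.

Open Scope C_scope.

Definition Cexp (z : C) : C :=
  ((exp (Re z) * cos (Im z))%R, (exp (Re z) * sin (Im z))%R).

(** Integral of [F] over |w| = 1, traversed once counterclockwise: the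
    parametrization is w = e^{it}, 0 <= t <= 2 pi, so dw = i e^{it} dt.
    [C_R_CompleteNormedModule] is [C] as a real Banach space, which makes
    [RInt] the integral of a [C]-valued function of a real variable. *)
Definition circle_int (F : C -> C) : C :=
  RInt (V := C_R_CompleteNormedModule)
    (fun t : R => F (Cexp (Ci * t)) * (Ci * Cexp (Ci * t))) 0%R (2 * PI)%R.

Definition entire (f : C -> C) : Prop :=
  forall z : C, ex_derive (K := C_AbsRing) (V := C_NormedModule) f z.

Definition polynomial (f : C -> C) : Prop :=
  exists (d : nat) (a : nat -> C),
    forall z : C, f z = sum_n (G := C_AbelianGroup) (fun j => a j * z ^ j) d.

Definition transcendental_entire (f : C -> C) : Prop :=
  entire f /\ ~ polynomial f.

(** [C_derive] is a total operator that returns the complex derivative where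
    it exists; for an entire function all the iterates are therefore the
    genuine derivatives. *)
Definition C_derive_n (f : C -> C) (m : nat) : C -> C :=
  Nat.iter m C_derive f.

(** The differential equation f^(n) - z f^(k) - f = 0 on the whole plane. *)
Definition entire_solution (n k : nat) (f : C -> C) : Prop :=
  entire f /\
  forall z : C, C_derive_n f n z - z * C_derive_n f k z - f z = 0.

(** The natural-number subtractions are exact when 1 < k < n. *)
Definition psi (n k : nat) (z : C) : C :=
  / (2 * PI * Ci) *
  circle_int (fun w : C =>
    w ^ (k - 2) *
    Cexp (z / w - 1 / (INR (n - k + 1) * w ^ (n - k + 1))
          - w ^ (k - 1) / INR (k - 1))).

(* Main.v *)
(** Differentiating under the integral multiplies the integrand by [1/w], so the equation for [psi]
    says that the integral of the exact derivative of [exp(z/w - w^{-p}/p - w^q/q)] over the circle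
    vanishes, where [p = n - k + 1] and [q = k - 1].

    A polynomial solution must be zero: since [k >= 2], both [f^(n)] and [z f^(k)] have smaller
    degree than [f]. If [psi] were zero, then every derivative would vanish at [0]; summing these
    with the coefficients of the power series of [exp(w^{-p}/p)] cancels the factor
    [exp(-w^{-p}/p)] and gives that the integral of [w^{-1} exp(-w^q/q)] is [0], whereas expanding
    this exponential shows that it is [2 pi i]. *)

Require Import Defs.
From Stdlib Require Import Factorial Lia Lra FunctionalExtensionality.

Local Notation is_Cderive := (@is_derive C_AbsRing C_NormedModule).
Local Notation is_CInt := (@is_RInt C_R_NormedModule).

(** * Complex-valued functions of a real variable *)

(** Splitting into components lets the real chain rule and the real fundamental theorem of calculus
    be applied directly. *)
Definition derive_re_im (f f' : R -> C) : Prop :=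
  forall t : R, is_derive (fun s => Re (f s)) t (Re (f' t)) /\
                is_derive (fun s => Im (f s)) t (Im (f' t)).

Definition Ccont (f : R -> C) : Prop :=
  forall t : R, continuous (fun s => Re (f s)) t /\ continuous (fun s => Im (f s)) t.

Lemma derive_re_im_ext (f g f' g' : R -> C) :
  (forall t, f t = g t) -> (forall t, f' t = g' t) ->
  derive_re_im f f' -> derive_re_im g g'.
Proof.
  intros Hf Hf' H t. rewrite <- Hf'. destruct (H t) as [H1 H2].
  split; [apply (is_derive_ext (fun s => Re (f s))) | apply (is_derive_ext (fun s => Im (f s)))];
    auto; intros s; now rewrite Hf.
Qed.

Lemma derive_re_im_const (c : C) : derive_re_im (fun _ => c) (fun _ => 0).
Proof. intros t; split; simpl; apply @is_derive_const. Qed.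

Lemma derive_re_im_plus (f g f' g' : R -> C) :
  derive_re_im f f' -> derive_re_im g g' ->
  derive_re_im (fun t => f t + g t) (fun t => f' t + g' t).
Proof.
  intros Hf Hg t. destruct (Hf t), (Hg t).
  split; simpl; apply @is_derive_plus; auto.
Qed.

Lemma is_derive_Rmult (u v : R -> R) (t du dv : R) :
  is_derive u t du -> is_derive v t dv ->
  is_derive (fun s => u s * v s)%R t (du * v t + u t * dv)%R.
Proof. intros Hu Hv. exact (@is_derive_mult R_AbsRing u v t du dv Hu Hv Rmult_comm). Qed.

Lemma derive_re_im_mult (f g f' g' : R -> C) :
  derive_re_im f f' -> derive_re_im g g' ->
  derive_re_im (fun t => f t * g t) (fun t => f' t * g t + f t * g' t).
Proof.
  intros Hf Hg t. destruct (Hf t) as [A B], (Hg t) as [D E].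
  split.
  - evar_last.
    + exact (@is_derive_minus R_AbsRing R_NormedModule _ _ _ _ _
        (is_derive_Rmult _ _ _ _ _ A D) (is_derive_Rmult _ _ _ _ _ B E)).
    + unfold minus, plus, opp, Re, Im; simpl; ring.
  - evar_last.
    + exact (@is_derive_plus R_AbsRing R_NormedModule _ _ _ _ _
        (is_derive_Rmult _ _ _ _ _ A E) (is_derive_Rmult _ _ _ _ _ B D)).
    + unfold plus, Re, Im; simpl; ring.
Qed.

Lemma derive_re_im_scal (c : C) (f f' : R -> C) :
  derive_re_im f f' -> derive_re_im (fun t => c * f t) (fun t => c * f' t).
Proof.
  intros Hf.
  refine (derive_re_im_ext _ _ _ _ _ _ (derive_re_im_mult _ _ _ _ (derive_re_im_const c) Hf)).
  - reflexivity.
  - intros t; cbv beta; ring.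
Qed.

Lemma derive_re_im_Cexp (f f' : R -> C) :
  derive_re_im f f' -> derive_re_im (fun t => Cexp (f t)) (fun t => f' t * Cexp (f t)).
Proof.
  intros Hf t. destruct (Hf t) as [A B].
  pose proof (is_derive_comp exp _ t _ _ (is_derive_exp _) A) as HE.
  pose proof (is_derive_comp cos _ t _ _ (is_derive_cos _) B) as HC.
  pose proof (is_derive_comp sin _ t _ _ (is_derive_sin _) B) as HS.
  split.
  - evar_last.
    + exact (is_derive_Rmult _ _ _ _ _ HE HC).
    + unfold scal; simpl; unfold mult; simpl; unfold Re, Im; ring.
  - evar_last.
    + exact (is_derive_Rmult _ _ _ _ _ HE HS).
    + unfold scal; simpl; unfold mult; simpl; unfold Re, Im; ring.
Qed.

Lemma Ccont_derive (f f' : R -> C) : derive_re_im f f' -> Ccont f.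
Proof.
  intros H t; destruct (H t); split;
    apply @ex_derive_continuous; eexists; eauto.
Qed.

Lemma Ccont_const (c : C) : Ccont (fun _ => c).
Proof. exact (Ccont_derive _ _ (derive_re_im_const c)). Qed.

Lemma Ccont_plus (f g : R -> C) : Ccont f -> Ccont g -> Ccont (fun t => f t + g t).
Proof.
  intros Hf Hg t; destruct (Hf t), (Hg t); split; simpl; apply @continuous_plus; auto.
Qed.

Lemma Ccont_mult (f g : R -> C) : Ccont f -> Ccont g -> Ccont (fun t => f t * g t).
Proof.
  intros Hf Hg t; destruct (Hf t) as [A B], (Hg t) as [D E]; split.
  - exact (@continuous_minus R_UniformSpace R_AbsRing R_NormedModule _ _ _
      (@continuous_mult R_UniformSpace R_AbsRing _ _ _ A D)
      (@continuous_mult R_UniformSpace R_AbsRing _ _ _ B E)).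
  - exact (@continuous_plus R_UniformSpace R_AbsRing R_NormedModule _ _ _
      (@continuous_mult R_UniformSpace R_AbsRing _ _ _ A E)
      (@continuous_mult R_UniformSpace R_AbsRing _ _ _ B D)).
Qed.

Lemma Ccont_pow (f : R -> C) (n : nat) : Ccont f -> Ccont (fun t => f t ^ n).
Proof.
  intros Hf; induction n as [|n IH]; [exact (Ccont_const 1) | exact (Ccont_mult _ _ Hf IH)].
Qed.

Lemma Ccont_minus (f g : R -> C) : Ccont f -> Ccont g -> Ccont (fun t => f t - g t).
Proof.
  intros Hf Hg t; destruct (Hf t), (Hg t); split; simpl; apply @continuous_minus; auto.
Qed.

Lemma Ccont_Cexp (f : R -> C) : Ccont f -> Ccont (fun t => Cexp (f t)).
Proof.
  intros Hf t; destruct (Hf t) as [A B].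
  pose proof (continuous_exp_comp _ _ A) as HE.
  split.
  - exact (@continuous_mult R_UniformSpace R_AbsRing _ _ _ HE (continuous_cos_comp _ _ B)).
  - exact (@continuous_mult R_UniformSpace R_AbsRing _ _ _ HE (continuous_sin_comp _ _ B)).
Qed.

(** The continuous real function [Cmod (f t)] attains its maximum on a compact interval. *)
Lemma Ccont_bounded (f : R -> C) (a b : R) :
  (a <= b)%R -> Ccont f -> exists M : R, forall t, (a <= t <= b)%R -> (Cmod (f t) <= M)%R.
Proof.
  intros Hab Hf.
  destruct (continuity_ab_maj (fun t => Cmod (f t)) a b Hab) as [x [Hx _]].
  - intros t _. apply continuity_pt_filterlim.
    destruct (Hf t) as [A B].
    apply (continuous_comp (fun t => Re (f t) ^ 2 + Im (f t) ^ 2)%R sqrt).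
    + apply (continuous_ext (fun t => Re (f t) * Re (f t) + Im (f t) * Im (f t))%R).
      { intros s; match goal with |- ?a = ?b => change (@eq R a b) end; ring. }
      exact (@continuous_plus R_UniformSpace R_AbsRing R_NormedModule _ _ _
        (@continuous_mult R_UniformSpace R_AbsRing _ _ _ A A)
        (@continuous_mult R_UniformSpace R_AbsRing _ _ _ B B)).
    + apply continuous_sqrt.
  - exists (Cmod (f x)); exact Hx.
Qed.

(** * Integrals of complex-valued functions over a real interval *)

Lemma is_CInt_re_im (f : R -> C) (a b : R) (l : C) :
  is_CInt f a b l <->
  is_RInt (fun t => Re (f t)) a b (Re l) /\ is_RInt (fun t => Im (f t)) a b (Im l).
Proof.
  split.
  - intros H; split.
    + exact (@is_RInt_fct_extend_fst R_NormedModule R_NormedModule f a b l H).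
    + exact (@is_RInt_fct_extend_snd R_NormedModule R_NormedModule f a b l H).
  - intros [A B]. destruct l as [x y].
    exact (@is_RInt_fct_extend_pair R_NormedModule R_NormedModule f a b x y A B).
Qed.

Lemma is_CInt_Cmult (c : C) (f : R -> C) (a b : R) (l : C) :
  is_CInt f a b l -> is_CInt (fun t => c * f t) a b (c * l).
Proof.
  rewrite !is_CInt_re_im. intros [A B]; split.
  - exact (@is_RInt_minus R_NormedModule _ _ _ _ _ _
      (@is_RInt_scal R_NormedModule _ _ _ (Re c) _ A)
      (@is_RInt_scal R_NormedModule _ _ _ (Im c) _ B)).
  - exact (@is_RInt_plus R_NormedModule _ _ _ _ _ _
      (@is_RInt_scal R_NormedModule _ _ _ (Re c) _ B)
      (@is_RInt_scal R_NormedModule _ _ _ (Im c) _ A)).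
Qed.

Lemma ex_CInt (f : R -> C) (a b : R) : Ccont f -> exists l : C, is_CInt f a b l.
Proof.
  intros Hf.
  destruct (ex_RInt_continuous (V := R_CompleteNormedModule) (fun t => Re (f t)) a b) as [x Hx].
  { intros t _; apply Hf. }
  destruct (ex_RInt_continuous (V := R_CompleteNormedModule) (fun t => Im (f t)) a b) as [y Hy].
  { intros t _; apply Hf. }
  exists (x, y). apply is_CInt_re_im; now split.
Qed.

(** Fundamental theorem of calculus, component by component. It yields the Taylor remainder formula
    and the vanishing of integrals of exact derivatives around the circle. *)
Lemma is_CInt_derive (f f' : R -> C) (a b : R) :
  derive_re_im f f' -> Ccont f' -> is_CInt f' a b (f b - f a).
Proof.
  intros H K. apply is_CInt_re_im; split.
  - apply (is_RInt_derive (fun t => Re (f t)) (fun t => Re (f' t)));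
      intros t _; [apply H | apply K].
  - apply (is_RInt_derive (fun t => Im (f t)) (fun t => Im (f' t)));
      intros t _; [apply H | apply K].
Qed.

Lemma norm_C_R (x : C) : @norm R_AbsRing C_R_NormedModule x = Cmod x.
Proof.
  change (sqrt (Rabs (fst x) ^ 2 + Rabs (snd x) ^ 2) = sqrt (fst x ^ 2 + snd x ^ 2)).
  f_equal. now rewrite !pow2_abs.
Qed.

Lemma Cmod_CInt_le (f : R -> C) (g : R -> R) (a b : R) (lf : C) (lg : R) :
  (a <= b)%R -> (forall t, (a <= t <= b)%R -> (Cmod (f t) <= g t)%R) ->
  is_CInt f a b lf -> is_RInt g a b lg -> (Cmod lf <= lg)%R.
Proof.
  intros Hab Hfg Hf Hg. rewrite <- norm_C_R.
  refine (norm_RInt_le f g a b lf lg Hab _ Hf Hg).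
  intros t Ht. rewrite norm_C_R. now apply Hfg.
Qed.

Lemma is_CInt_plus (f g : R -> C) (a b : R) (lf lg : C) :
  is_CInt f a b lf -> is_CInt g a b lg -> is_CInt (fun t => f t + g t) a b (lf + lg).
Proof. exact (@is_RInt_plus C_R_NormedModule f g a b lf lg). Qed.

Lemma is_CInt_minus (f g : R -> C) (a b : R) (lf lg : C) :
  is_CInt f a b lf -> is_CInt g a b lg -> is_CInt (fun t => f t - g t) a b (lf - lg).
Proof. exact (@is_RInt_minus C_R_NormedModule f g a b lf lg). Qed.

Lemma is_CInt_ext (f g : R -> C) (a b : R) (l : C) :
  (forall t, f t = g t) -> is_CInt f a b l -> is_CInt g a b l.
Proof. intros H; apply is_RInt_ext; auto. Qed.

Lemma is_CInt_unique (f : R -> C) (a b : R) (l l' : C) :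
  is_CInt f a b l -> is_CInt f a b l' -> l = l'.
Proof.
  intros H H'.
  rewrite <- (@is_RInt_unique C_R_CompleteNormedModule f a b l H).
  exact (@is_RInt_unique C_R_CompleteNormedModule f a b l' H').
Qed.

Lemma Cmod_CInt_le_const (f : R -> C) (a b M : R) (l : C) :
  (a <= b)%R -> (forall t, (a <= t <= b)%R -> (Cmod (f t) <= M)%R) ->
  is_CInt f a b l -> (Cmod l <= (b - a) * M)%R.
Proof.
  intros Hab Hf Hl. apply (Cmod_CInt_le f (fun _ => M) a b l); auto.
  apply (@is_RInt_const R_NormedModule).
Qed.

(** * Taylor bounds for the exponential *)

Lemma Cexp_0 : Cexp 0 = 1.
Proof. unfold Cexp; simpl. now rewrite exp_0, cos_0, sin_0, Rmult_1_l, Rmult_0_r. Qed.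

Lemma Cexp_plus (x y : C) : Cexp (x + y) = Cexp x * Cexp y.
Proof.
  unfold Cexp, Cmult; simpl. rewrite exp_plus, cos_plus, sin_plus.
  unfold Re, Im; f_equal; ring.
Qed.

Lemma exp_le_exp (x y : R) : (x <= y)%R -> (exp x <= exp y)%R.
Proof.
  intros [H | ->]; [left; now apply exp_increasing | apply Rle_refl].
Qed.

Lemma Cmod_Cexp_le (x : C) : (Cmod (Cexp x) <= exp (Cmod x))%R.
Proof.
  replace (Cmod (Cexp x)) with (exp (Re x)).
  - apply exp_le_exp.
    exact (Rle_trans _ _ _ (Rle_abs _) (re_le_Cmod x)).
  - unfold Cmod, Cexp; simpl.
    replace (_ + _)%R with (Rsqr (exp (Re x)) * (Rsqr (sin (Im x)) + Rsqr (cos (Im x))))%R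
      by (unfold Rsqr; ring).
    rewrite sin2_cos2, Rmult_1_r, sqrt_Rsqr; auto. left; apply exp_pos.
Qed.

(** [N] counts terms, so the degree is at most [N - 1] and the remainder has order [N]. The empty
    sum at [N = 0] starts the remainder induction from [Cexp] itself. *)
Fixpoint exp_taylor (N : nat) (x : C) : C :=
  match N with
  | O => 0
  | S N => exp_taylor N x + x ^ N * / INR (fact N)
  end.

Lemma Ccont_exp_taylor (N : nat) (f : R -> C) :
  Ccont f -> Ccont (fun t => exp_taylor N (f t)).
Proof.
  intros Hf; induction N as [|N IH]; [exact (Ccont_const 0)|].
  exact (Ccont_plus _ _ IH (Ccont_mult _ _ (Ccont_pow _ N Hf) (Ccont_const _))).
Qed.

Lemma exp_taylor_0 (N : nat) : exp_taylor (S N) 0 = 1.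
Proof.
  induction N as [|N IH].
  - simpl. field.
  - change (exp_taylor (S N) 0 + 0 ^ S N * / INR (fact (S N)) = 1). rewrite IH.
    simpl Cpow. ring.
Qed.

Lemma derive_re_im_id : derive_re_im RtoC (fun _ => 1).
Proof. intros t; split; simpl; [apply @is_derive_id | apply @is_derive_const]. Qed.

Lemma derive_re_im_pow (x : C) (n : nat) :
  derive_re_im (fun s => (s * x) ^ S n) (fun s => INR (S n) * x * (s * x) ^ n).
Proof.
  assert (H1 : derive_re_im (fun s : R => s * x) (fun _ => x)).
  { refine (derive_re_im_ext _ _ _ _ _ _ (derive_re_im_scal x _ _ derive_re_im_id));
      intros; cbv beta; ring. }
  induction n as [|n IH].
  - refine (derive_re_im_ext _ _ _ _ _ _ H1); intros; simpl; ring.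
  - refine (derive_re_im_ext _ _ _ _ _ _ (derive_re_im_mult _ _ _ _ H1 IH)).
    + reflexivity.
    + intros t; cbv beta. rewrite (S_INR (S n)), RtoC_plus. simpl Cpow. ring.
Qed.

Lemma INR_fact_C_neq_0 (n : nat) : RtoC (INR (fact n)) <> 0.
Proof. intros H; apply RtoC_inj in H; revert H; apply INR_fact_neq_0. Qed.

(** Along the segment from 0 to [x], differentiation lowers the number of terms by one; this shift
    drives the induction on the remainder. *)
Lemma derive_exp_taylor (x : C) (N : nat) :
  derive_re_im (fun s => exp_taylor (S N) (s * x)) (fun s => x * exp_taylor N (s * x)).
Proof.
  induction N as [|N IH].
  - refine (derive_re_im_ext _ _ _ _ _ _ (derive_re_im_const 1)); intros; simpl.
    + field.
    + ring.
  - refine (derive_re_im_ext _ _ _ _ _ _ (derive_re_im_plus _ _ _ _ IH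
      (derive_re_im_scal (/ INR (fact (S N))) _ _ (derive_re_im_pow x N)))).
    + intros t. change (exp_taylor (S N) (t * x) + / INR (fact (S N)) * (t * x) ^ S N =
        exp_taylor (S N) (t * x) + (t * x) ^ S N * / INR (fact (S N))). ring.
    + intros t. cbv beta.
      change (exp_taylor (S N) (t * x)) with
        (exp_taylor N (t * x) + (t * x) ^ N * / INR (fact N)).
      rewrite fact_simpl, mult_INR, RtoC_mult.
      assert (RtoC (INR (S N)) <> 0).
      { intros H; apply RtoC_inj in H; revert H; now apply not_0_INR. }
      pose proof (INR_fact_C_neq_0 N).
      field; auto.
Qed.

(** Induction on [N]: the remainder of order [N + 1] along the segment vanishes at 0 and has
    derivative [x] times the remainder of order [N], so it is the integral over [0,1] of a quantity
    bounded by the induction hypothesis. *)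
Lemma Cexp_taylor_bound (N : nat) (x : C) :
  (Cmod (Cexp x - exp_taylor N x) <= exp (Cmod x) * Cmod x ^ N / INR (fact N))%R.
Proof.
  revert x; induction N as [|N IH]; intros x.
  - simpl. unfold Rdiv. rewrite Rinv_1, !Rmult_1_r.
    replace (Cexp x - 0) with (Cexp x) by ring. apply Cmod_Cexp_le.
  - pose (r := fun (n : nat) (s : R) => Cexp (s * x) - exp_taylor n (s * x)).
    assert (Hid : derive_re_im (fun s : R => s * x) (fun _ => x)).
    { refine (derive_re_im_ext _ _ _ _ _ _ (derive_re_im_scal x _ _ derive_re_im_id));
        intros; cbv beta; ring. }
    pose proof (derive_re_im_Cexp _ _ Hid) as HE.
    assert (HD : derive_re_im (r (S N)) (fun s => x * r N s)).
    { refine (derive_re_im_ext _ _ _ _ _ _ (derive_re_im_plus _ _ _ _ HE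
        (derive_re_im_scal (-(1)) _ _ (derive_exp_taylor x N))));
      intros t; unfold r; cbv beta; ring. }
    assert (HC : Ccont (fun s => x * r N s)).
    { apply (Ccont_mult (fun _ => x) (r N)); [apply Ccont_const|].
      exact (Ccont_minus _ _ (Ccont_derive _ _ HE)
               (Ccont_exp_taylor N _ (Ccont_derive _ _ Hid))). }
    pose proof (is_CInt_derive _ _ 0 1 HD HC) as HI.
    replace (r (S N) 1%R - r (S N) 0%R) with (Cexp x - exp_taylor (S N) x) in HI.
    2:{ unfold r. rewrite !Cmult_0_l, !Cmult_1_l, Cexp_0, exp_taylor_0. ring. }
    refine (Cmod_CInt_le _
      (* The majorant is the induction hypothesis at [s * x], with [exp (s * Cmod x)] enlarged to
         [exp (Cmod x)]. *)
      (fun s => exp (Cmod x) * Cmod x ^ S N / INR (fact N) * s ^ N)%R _ _ _ _ Rle_0_1 _ HI _).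
    + intros t Ht. rewrite Cmod_mult.
      assert (Ht' : Cmod (t * x) = (t * Cmod x)%R).
      { rewrite Cmod_mult, Cmod_R, Rabs_pos_eq; lra. }
      apply Rle_trans with (Cmod x * (exp (Cmod x) * (t * Cmod x) ^ N / INR (fact N)))%R.
      * apply Rmult_le_compat_l; [apply Cmod_ge_0|].
        eapply Rle_trans; [apply IH|]. rewrite Ht'.
        apply Rmult_le_compat_r; [left; apply Rinv_0_lt_compat, INR_fact_lt_0|].
        apply Rmult_le_compat_r; [apply pow_le, Rmult_le_pos; [lra | apply Cmod_ge_0]|].
        apply exp_le_exp.
        pose proof (Cmod_ge_0 x). nra.
      * rewrite Rpow_mult_distr. right. simpl. unfold Rdiv. ring.
    + set (c := (exp (Cmod x) * Cmod x ^ S N)%R).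
      pose proof (INR_fact_neq_0 N) as H1.
      pose proof (not_0_INR (S N) (Nat.neq_succ_0 N)) as H2.
      evar_last.
      (* Integrating [s ^ N] contributes the factor [1 / (N + 1)] that turns [N!] into
         [(N + 1)!]. *)
      * apply (is_RInt_derive (fun s => c / INR (fact (S N)) * s ^ S N)%R); intros t _.
        -- auto_derive; auto.
           change (fact N + N * fact N)%nat with (S N * fact N)%nat. rewrite mult_INR.
           change (match N with O => 1 | S _ => INR N + 1 end)%R with (INR (S N)).
           field; auto.
        -- apply (@ex_derive_continuous R_AbsRing R_NormedModule). auto_derive; auto.
      * unfold minus, plus, opp; simpl pow; simpl AbelianGroup.opp.
        rewrite pow1. simpl. unfold Rdiv; ring.
Qed.

Lemma Cexp_taylor_bound_le (N : nat) (x : C) (K : R) :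
  (Cmod x <= K)%R -> (Cmod (Cexp x - exp_taylor N x) <= exp K * (K ^ N / INR (fact N)))%R.
Proof.
  intros H. pose proof (Cmod_ge_0 x) as H0.
  eapply Rle_trans; [apply Cexp_taylor_bound|].
  unfold Rdiv; rewrite Rmult_assoc.
  apply Rmult_le_compat.
  - left; apply exp_pos.
  - apply Rmult_le_pos; [now apply pow_le | left; apply Rinv_0_lt_compat, INR_fact_lt_0].
  - now apply exp_le_exp.
  - apply Rmult_le_compat_r; [left; apply Rinv_0_lt_compat, INR_fact_lt_0|].
    now apply pow_incr.
Qed.

(** * Power series and derivatives under the integral sign *)

Lemma is_CInt_mult_Cexp (A B : R -> C) (a b : R) (L : C) :
  (a <= b)%R -> Ccont A -> Ccont B ->
  is_CInt A a b L ->
  (forall j, is_CInt (fun t => A t * B t ^ S j) a b (RtoC 0)) ->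
  is_CInt (fun t => A t * Cexp (B t)) a b L.
Proof.
  intros Hab HA HB H0 HS.
  (* Every partial sum already integrates to [L]: the constant term gives [L] and each higher term
     gives 0. *)
  assert (HN : forall N, is_CInt (fun t => A t * exp_taylor (S N) (B t)) a b L).
  { induction N as [|N IH].
    - refine (is_CInt_ext _ _ _ _ _ _ H0). intros t; simpl; field.
    - replace L with (L + / INR (fact (S N)) * 0) by ring.
      refine (is_CInt_ext _ _ _ _ _ _
        (is_CInt_plus _ _ _ _ _ _ IH (is_CInt_Cmult (/ INR (fact (S N))) _ _ _ _ (HS N)))).
      intros t; cbv beta.
      change (exp_taylor (S (S N)) (B t)) with
        (exp_taylor (S N) (B t) + B t ^ S N * / INR (fact (S N))). ring. }
  destruct (ex_CInt (fun t => A t * Cexp (B t)) a b) as [l Hl].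
  { exact (Ccont_mult _ _ HA (Ccont_Cexp _ HB)). }
  destruct (Ccont_bounded A a b Hab HA) as [M HM].
  destruct (Ccont_bounded B a b Hab HB) as [K HK].
  assert (HM0 : (0 <= M)%R).
  { apply Rle_trans with (Cmod (A a)); [apply Cmod_ge_0 | apply HM; lra]. }
  pose (c := ((b - a) * (M * exp K))%R).
  assert (Hc : (0 <= c)%R).
  { apply Rmult_le_pos; [lra|]. apply Rmult_le_pos; [assumption | left; apply exp_pos]. }
  (* With [M] bounding [A] and [K] bounding [B] on the interval, the Taylor remainder is small
     uniformly in [t]. *)
  assert (Hd : forall N, (Cmod (l - L) <= c * (K ^ S N / INR (fact (S N))))%R).
  { intros N. unfold c. rewrite Rmult_assoc.
    refine (Cmod_CInt_le_const _ _ _ _ _ Hab _ (is_CInt_minus _ _ _ _ _ _ Hl (HN N))).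
    intros t Ht. cbv beta.
    replace (A t * Cexp (B t) - A t * exp_taylor (S N) (B t)) with
      (A t * (Cexp (B t) - exp_taylor (S N) (B t))) by ring.
    rewrite Cmod_mult, Rmult_assoc.
    apply Rmult_le_compat; try apply Cmod_ge_0; [now apply HM|].
    now apply Cexp_taylor_bound_le, HK. }
  assert (E : l - L = 0).
  { apply Cmod_eq_0. destruct (Cmod_ge_0 (l - L)) as [Hpos | <-]; [exfalso | reflexivity].
    (* [K^N / N!] tends to 0, so it beats any positive gap between [l] and [L]. The divisor is
       [c + 1] because [c] may be 0. *)
    destruct (cv_speed_pow_fact K (Cmod (l - L) / (c + 1))%R) as [N HNN].
    { apply Rdiv_lt_0_compat; lra. }
    specialize (HNN (S N) ltac:(lia)). specialize (Hd N).
    unfold Rdist in HNN. rewrite Rminus_0_r in HNN.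
    apply Rabs_def2 in HNN. destruct HNN as [HNN _].
    apply (Rmult_lt_compat_l (c + 1)) in HNN; [|lra].
    replace ((c + 1) * (Cmod (l - L) / (c + 1)))%R with (Cmod (l - L)) in HNN by (field; lra).
    set (e := (K ^ S N / INR (fact (S N)))%R) in *.
    change (K ^ S N / INR (Factorial.fact (S N)))%R with e in HNN.
    assert (0 < e)%R by nra. nra. }
  replace L with l; [assumption|].
  replace l with (l - L + L) by ring. rewrite E; ring.
Qed.

Lemma is_Cderive_intro (f : C -> C) (z l : C) :
  (forall eps : posreal, exists delta : posreal, forall y : C,
     (Cmod (y - z) < delta)%R -> (Cmod (f y - f z - (y - z) * l) <= eps * Cmod (y - z))%R) ->
  is_Cderive f z l.
Proof.
  intros H. split.
  - apply (@is_linear_scal_l C_AbsRing C_NormedModule l).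
  - intros x Hx eps.
    (* The general derivative quantifies over limit points of the neighbourhood filter of [z]; the
       only one is [z]. *)
    rewrite <- (@is_filter_lim_locally_unique C_AbsRing (AbsRing_NormedModule C_AbsRing) z x Hx).
    destruct (H eps) as [delta Hd]. exists delta. intros y Hy. exact (Hd y Hy).
Qed.

(** The error of the linear approximation is the integral of [A e^{zB} (e^{hB} - 1 - hB)], which is
    of order [h^2] uniformly in [t]. *)
Lemma is_Cderive_CInt_Cexp (A B : R -> C) (a b : R) (F F' : C -> C) :
  (a <= b)%R -> Ccont A -> Ccont B ->
  (forall z, is_CInt (fun t => A t * Cexp (z * B t)) a b (F z)) ->
  (forall z, is_CInt (fun t => A t * B t * Cexp (z * B t)) a b (F' z)) ->
  forall z : C, is_Cderive F z (F' z).
Proof.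
  intros Hab HA HB HF HF' z.
  assert (HE : Ccont (fun t => A t * Cexp (z * B t))).
  { exact (Ccont_mult _ _ HA (Ccont_Cexp _ (Ccont_mult _ _ (Ccont_const z) HB))). }
  destruct (Ccont_bounded _ a b Hab HE) as [M HM].
  destruct (Ccont_bounded B a b Hab HB) as [K HK].
  assert (HM0 : (0 <= M)%R).
  { eapply Rle_trans; [apply Cmod_ge_0 | apply (HM a); lra]. }
  assert (HK0 : (0 <= K)%R).
  { eapply Rle_trans; [apply Cmod_ge_0 | apply (HK a); lra]. }
  (* Interval length, times the bound for [A e^{zB}] at the fixed [z], times the second-order Taylor
     bound for [e^{hB}] with [Cmod h <= 1]. *)
  pose (c := ((b - a) * (M * (exp K * K ^ 2)))%R).
  assert (Hc : (0 <= c)%R).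
  { repeat apply Rmult_le_pos; try lra. left; apply exp_pos. }
  assert (Hq : forall h, (Cmod h <= 1)%R ->
    (Cmod (F (z + h)%C - F z - h * F' z) <= c * Cmod h ^ 2)%R).
  { intros h Hh. unfold c. rewrite Rmult_assoc.
    refine (Cmod_CInt_le_const _ _ _ _ _ Hab _ (is_CInt_minus _ _ _ _ _ _
      (is_CInt_minus _ _ _ _ _ _ (HF (z + h)) (HF z)) (is_CInt_Cmult h _ _ _ _ (HF' z)))).
    intros t Ht. cbv beta.
    replace (Cexp ((z + h) * B t)) with (Cexp (z * B t) * Cexp (h * B t))
      by (rewrite <- Cexp_plus; f_equal; ring).
    replace (A t * (Cexp (z * B t) * Cexp (h * B t)) - A t * Cexp (z * B t) -
      h * (A t * B t * Cexp (z * B t))) with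
      (A t * Cexp (z * B t) * (Cexp (h * B t) - exp_taylor 2 (h * B t)))
      by (simpl; field).
    rewrite Cmod_mult, Rmult_assoc.
    apply Rmult_le_compat; try apply Cmod_ge_0; [now apply HM|].
    assert (HhB : (Cmod (h * B t) <= Cmod h * K)%R).
    { rewrite Cmod_mult. apply Rmult_le_compat_l; [apply Cmod_ge_0 | auto]. }
    pose proof (Cmod_ge_0 h).
    eapply Rle_trans; [apply (Cexp_taylor_bound_le 2 _ _ HhB)|].
    rewrite Rmult_assoc. apply Rmult_le_compat; [left; apply exp_pos | | apply exp_le_exp; nra |].
    - simpl. nra.
    - simpl. pose proof (Rmult_le_pos _ _ H HK0). nra. }
  apply is_Cderive_intro. intros eps.
  (* The bound 1 makes the quadratic estimate available; the other bound gives [c |h|^2 <= eps |h|],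
     with [c + 1] again guarding against [c = 0]. *)
  assert (Hdel : (0 < Rmin 1 (eps / (c + 1)))%R).
  { apply Rmin_pos; [lra | apply Rdiv_lt_0_compat; [apply cond_pos | lra]]. }
  exists (mkposreal _ Hdel). intros y Hy. simpl in Hy.
  pose proof (Rlt_le_trans _ _ _ Hy (Rmin_l _ _)) as H1.
  pose proof (Rlt_le_trans _ _ _ Hy (Rmin_r _ _)) as H2.
  replace (F y) with (F (z + (y - z))) by (f_equal; ring).
  eapply Rle_trans; [apply Hq; lra|].
  simpl. rewrite Rmult_1_r, <- Rmult_assoc.
  pose proof (Cmod_ge_0 (y - z)) as H3.
  apply Rmult_le_compat_r; [assumption|].
  apply (Rmult_lt_compat_l (c + 1)) in H2; [|lra].
  replace ((c + 1) * (eps / (c + 1)))%R with (pos eps) in H2 by (field; lra).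
  nra.
Qed.

(** * Polynomial solutions *)

Lemma is_Cderive_mul_var (g : C -> C) (z l : C) :
  is_Cderive g z l -> is_Cderive (fun y => y * g y) z (g z + z * l).
Proof.
  intros H.
  pose proof (filterdiff_scal_fct (K := C_AbsRing) (U := AbsRing_NormedModule C_AbsRing)
    (V := C_NormedModule) z (fun y => y) g
    (fun y => y) _ Cmult_comm (filterdiff_id _) H) as D.
  refine (filterdiff_ext_lin _ _ _ D _).
  intros y. unfold plus, scal; simpl; unfold mult; simpl; ring.
Qed.

Lemma is_Cderive_scal (c : C) (g : C -> C) (z l : C) :
  is_Cderive g z l -> is_Cderive (fun y => c * g y) z (c * l).
Proof.
  intros H.
  pose proof (filterdiff_scal_r_fct (K := C_AbsRing) (U := AbsRing_NormedModule C_AbsRing)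
    (V := C_NormedModule) c g _ Cmult_comm H) as D.
  refine (filterdiff_ext_lin _ _ _ D _).
  intros y. unfold scal; simpl; unfold mult; simpl; ring.
Qed.

(** Horner form: [f] is a polynomial function with fewer than [d] coefficients. *)
Fixpoint poly_lt (d : nat) (f : C -> C) : Prop :=
  match d with
  | O => forall z, f z = 0
  | S d => exists (c : C) (g : C -> C), poly_lt d g /\ forall z, f z = c + z * g z
  end.

Lemma poly_lt_ext (d : nat) (f g : C -> C) :
  (forall z, f z = g z) -> poly_lt d f -> poly_lt d g.
Proof. intros H. now rewrite (functional_extensionality f g H). Qed.

Lemma poly_lt_S (d : nat) (f : C -> C) : poly_lt d f -> poly_lt (S d) f.
Proof.
  revert f; induction d as [|d IH]; intros f.
  - intros H. exists 0, (fun _ => 0). split; [easy|]. intros z; rewrite (H z); ring.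
  - intros [c [g [Hg Hf]]]. exists c, g; auto.
Qed.

Lemma poly_lt_le (d e : nat) (f : C -> C) : (d <= e)%nat -> poly_lt d f -> poly_lt e f.
Proof. induction 1; auto. intros Hf. now apply poly_lt_S, IHle. Qed.

Lemma poly_lt_plus (d : nat) (f g : C -> C) :
  poly_lt d f -> poly_lt d g -> poly_lt d (fun z => f z + g z).
Proof.
  revert f g; induction d as [|d IH]; intros f g.
  - intros Hf Hg z. rewrite Hf, Hg; ring.
  - intros [a [u [Hu Hf]]] [b [v [Hv Hg]]].
    exists (a + b), (fun z => u z + v z). split; [auto|].
    intros z; rewrite Hf, Hg; ring.
Qed.

Lemma poly_lt_scal (d : nat) (a : C) (f : C -> C) :
  poly_lt d f -> poly_lt d (fun z => a * f z).
Proof.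
  revert f; induction d as [|d IH]; intros f.
  - intros Hf z. rewrite Hf; ring.
  - intros [c [g [Hg Hf]]]. exists (a * c), (fun z => a * g z). split; [auto|].
    intros z; rewrite Hf; ring.
Qed.

Lemma poly_lt_mul_var (d : nat) (f : C -> C) :
  poly_lt (pred d) f -> poly_lt d (fun z => z * f z).
Proof.
  destruct d as [|d]; simpl.
  - intros Hf z; rewrite Hf; ring.
  - intros Hf. exists 0, f. split; [assumption|]. intros z; ring.
Qed.

Lemma polynomial_poly_lt (f : C -> C) : polynomial f -> exists d, poly_lt d f.
Proof.
  intros [d [a Hf]]. exists (S d).
  assert (Hmon : forall c j, poly_lt (S j) (fun z => c * z ^ j)).
  { intros c j. induction j as [|j IH].
    - exists c, (fun _ => 0). split; [easy|]. intros z; simpl; ring.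
    - apply (poly_lt_ext _ (fun z => z * (c * z ^ j))).
      + intros z; simpl; ring.
      + now apply poly_lt_mul_var. }
  apply (poly_lt_ext _ (fun z => sum_n (G := C_AbelianGroup) (fun j => a j * z ^ j) d)).
  { intros z; now rewrite Hf. }
  clear f Hf. induction d as [|d IH].
  - refine (poly_lt_ext _ _ _ _ (Hmon (a O) O)). intros z; now rewrite sum_O.
  - refine (poly_lt_ext _ _ _ _ (poly_lt_plus _ _ _ (poly_lt_S _ _ IH) (Hmon (a (S d)) (S d)))).
    intros z; now rewrite sum_Sn.
Qed.

(** Product rule on the Horner form: [c + z g] has derivative [g + z g'], and multiplying [g'] by
    [z] restores the coefficient that differentiating [g] removed. *)
Lemma poly_lt_is_derive (d : nat) (f : C -> C) :
  poly_lt d f -> exists f', poly_lt (pred d) f' /\ forall z, is_Cderive f z (f' z).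
Proof.
  assert (Hconst : forall (c : C) z, is_Cderive (fun _ => c) z (RtoC 0)).
  { intros c z. exact (@is_derive_const C_AbsRing C_NormedModule c z). }
  revert f; induction d as [|d IH]; intros f Hf.
  - exists (fun _ => 0). split; [easy|]. intros z.
    rewrite (functional_extensionality f (fun _ => 0) Hf). apply Hconst.
  - destruct Hf as [c [g [Hg Hf]]]. destruct (IH g Hg) as [g' [Hg' D]].
    exists (fun z => g z + z * g' z). split.
    + apply poly_lt_plus; [assumption | now apply poly_lt_mul_var].
    + intros z. rewrite (functional_extensionality f _ Hf).
      replace (g z + z * g' z) with (0 + (g z + z * g' z)) by ring.
      exact (@is_derive_plus C_AbsRing C_NormedModule _ _ _ _ _ (Hconst c z)
        (is_Cderive_mul_var g z _ (D z))).
Qed.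

Lemma poly_lt_C_derive_n (d m : nat) (f : C -> C) :
  poly_lt d f -> poly_lt (d - m) (C_derive_n f m).
Proof.
  intros Hf. induction m as [|m IH]; [now rewrite Nat.sub_0_r|].
  destruct (poly_lt_is_derive _ _ IH) as [f' [Hf' D]].
  replace (d - S m)%nat with (pred (d - m)) by lia.
  refine (poly_lt_ext _ _ _ _ Hf'). intros z. symmetry. now apply is_C_derive_unique.
Qed.

(** Descent on the number of coefficients: the equation rewrites [f] as [f^(n) - z f^(k)], which has
    room for one coefficient fewer, until none is left. *)
Lemma polynomial_solution_eq_0 (n k : nat) (f : C -> C) :
  (1 < k < n)%nat -> entire_solution n k f -> polynomial f -> forall z, f z = 0.
Proof.
  intros Hnk [_ Hode] Hpol. destruct (polynomial_poly_lt f Hpol) as [d Hd].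
  change (poly_lt 0 f). induction d as [|d IH]; [assumption|]. apply IH.
  apply (poly_lt_ext _ (fun z => C_derive_n f n z + (-(1)) * (z * C_derive_n f k z))).
  - intros z. replace (f z) with (0 + f z) by ring. rewrite <- (Hode z). ring.
  - apply poly_lt_plus.
    + apply poly_lt_le with (S d - n)%nat; [lia | now apply poly_lt_C_derive_n].
    + apply poly_lt_scal, poly_lt_mul_var.
      (* Here [k >= 2] is essential: one derivative pays for the factor [z], another lowers the
         degree. *)
      apply poly_lt_le with (S d - k)%nat; [lia | now apply poly_lt_C_derive_n].
Qed.

(** * The moments of the integrand on the circle *)

(** This is [w^r] on [w = e^{it}]. A real exponent treats positive and negative powers alike, and
    products simply add exponents. *)
Definition cis (r t : R) : C := Cexp (Ci * (r * t)).

Lemma cis_mult (r s t : R) : cis r t * cis s t = cis (r + s) t.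
Proof. unfold cis. rewrite <- Cexp_plus, RtoC_plus. f_equal; ring. Qed.

Lemma cis_0_l (t : R) : cis 0 t = 1.
Proof. unfold cis. rewrite Cmult_0_l, Cmult_0_r. apply Cexp_0. Qed.

Lemma cis_0_r (r : R) : cis r 0 = 1.
Proof. unfold cis. rewrite !Cmult_0_r. apply Cexp_0. Qed.

Lemma cis_opp_mult (r t : R) : cis (- r) t * cis r t = 1.
Proof. rewrite cis_mult, Rplus_opp_l. apply cis_0_l. Qed.

Lemma cis_neq_0 (r t : R) : cis r t <> 0.
Proof.
  intros E. pose proof (cis_opp_mult r t) as H. rewrite E, Cmult_0_r in H.
  apply RtoC_inj in H. now apply R1_neq_R0.
Qed.

Lemma cis_inv (r t : R) : / cis r t = cis (- r) t.
Proof.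
  pose proof (cis_neq_0 r t).
  transitivity (cis (- r) t * cis r t * / cis r t); [rewrite cis_opp_mult |]; field; assumption.
Qed.

Lemma cis_pow (r t : R) (n : nat) : cis r t ^ n = cis (r * INR n) t.
Proof.
  induction n as [|n IH]; [now rewrite Rmult_0_r, cis_0_l|].
  simpl Cpow. rewrite IH, cis_mult, S_INR. f_equal; ring.
Qed.

Lemma cis_2PI (n : nat) : cis (INR n) (2 * PI) = 1.
Proof.
  unfold cis, Cexp. simpl.
  replace (0 * (INR n * (2 * PI) - 0 * 0) - 1 * (INR n * 0 + 0 * (2 * PI)))%R with 0%R by ring.
  replace (0 * (INR n * 0 + 0 * (2 * PI)) + 1 * (INR n * (2 * PI) - 0 * 0))%R
    with (0 + 2 * INR n * PI)%R by ring.
  rewrite cos_period, sin_period, exp_0, cos_0, sin_0, Rmult_1_l, Rmult_0_r. reflexivity.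
Qed.

Lemma cis_opp_2PI (n : nat) : cis (- INR n) (2 * PI) = 1.
Proof. rewrite <- cis_inv, cis_2PI. field. Qed.

Lemma derive_re_im_cis (r : R) : derive_re_im (cis r) (fun t => Ci * r * cis r t).
Proof.
  apply (derive_re_im_Cexp (fun t => Ci * (r * t)) (fun _ => Ci * r)).
  refine (derive_re_im_ext _ _ _ _ _ _ (derive_re_im_scal (Ci * r) _ _ derive_re_im_id));
    intros; cbv beta; ring.
Qed.

Lemma Ccont_cis (r : R) : Ccont (cis r).
Proof. exact (Ccont_derive _ _ (derive_re_im_cis r)). Qed.

Lemma Ci_neq_0 : Ci <> 0.
Proof. intros H. apply (f_equal Im) in H. simpl in H. now apply R1_neq_R0. Qed.

(** The primitive [e^{irt} / (ir)] exists because [r = n + 1] is nonzero, and it takes equal values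
    at 0 and [2 PI]. *)
Lemma is_CInt_cis_period (n : nat) : is_CInt (cis (INR (S n))) 0 (2 * PI) (RtoC 0).
Proof.
  set (r := INR (S n)).
  assert (Hr : Ci * r <> 0).
  { apply Cmult_neq_0; [exact Ci_neq_0|]. intros H. apply RtoC_inj in H.
    revert H. now apply not_0_INR. }
  replace (RtoC 0) with (/ (Ci * r) * (cis r (2 * PI) - cis r 0)).
  - apply (is_CInt_ext (fun t => / (Ci * r) * (Ci * r * cis r t))).
    + intros t; cbv beta; field; now split; intros E; apply Hr; rewrite E; ring.
    + apply is_CInt_Cmult, is_CInt_derive; [apply derive_re_im_cis|].
      exact (Ccont_mult _ _ (Ccont_const _) (Ccont_cis r)).
  - unfold r. rewrite cis_2PI, cis_0_r. ring.
Qed.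

(** On [w = e^{it}], with [p = n - k + 1] and [q = k - 1]: the exponent of the integrand. *)
Definition expo (p q : nat) (z : C) (t : R) : C :=
  z * cis (-1) t - / INR p * cis (- INR p) t - / INR q * cis (INR q) t.

(** Since [dw = i w dt], this is [1/i] times the contour integral of [w^{q-1-m}] times the
    exponential. The index [m] counts factors [1/w], and [m = 0] is the integral in [psi], where
    [q - 1 = k - 2]. *)
Definition moment (p q m : nat) (z : C) : C :=
  RInt (V := C_R_CompleteNormedModule)
    (fun t => cis (INR q - INR m) t * Cexp (expo p q z t)) 0 (2 * PI).

Lemma Ccont_expo (p q : nat) (z : C) : Ccont (expo p q z).
Proof.
  unfold expo.
  refine (Ccont_minus _ _ (Ccont_minus _ _ _ _) _);
    exact (Ccont_mult _ _ (Ccont_const _) (Ccont_cis _)).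
Qed.

Lemma is_CInt_moment (p q m : nat) (z : C) :
  is_CInt (fun t => cis (INR q - INR m) t * Cexp (expo p q z t)) 0 (2 * PI) (moment p q m z).
Proof.
  destruct (ex_CInt (fun t => cis (INR q - INR m) t * Cexp (expo p q z t)) 0 (2 * PI)) as [l Hl].
  - exact (Ccont_mult _ _ (Ccont_cis _) (Ccont_Cexp _ (Ccont_expo p q z))).
  - unfold moment. now rewrite (@is_RInt_unique C_R_CompleteNormedModule _ _ _ _ Hl).
Qed.

Lemma two_PI_ge_0 : (0 <= 2 * PI)%R.
Proof. pose proof PI_RGT_0; lra. Qed.

(** The variable [z] enters only through [e^{z/w}], so differentiation brings down [1/w] and raises
    the index by one. *)
Lemma is_Cderive_moment (p q m : nat) (z : C) :
  is_Cderive (moment p q m) z (moment p q (S m) z).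
Proof.
  assert (E : forall z t, Cexp (expo p q z t) = Cexp (expo p q 0 t) * Cexp (z * cis (-1) t)).
  { intros y t. rewrite <- Cexp_plus. f_equal. unfold expo. ring. }
  apply (is_Cderive_CInt_Cexp (fun t => cis (INR q - INR m) t * Cexp (expo p q 0 t)) (cis (-1))
    0 (2 * PI)).
  - exact two_PI_ge_0.
  - exact (Ccont_mult _ _ (Ccont_cis _) (Ccont_Cexp _ (Ccont_expo p q 0))).
  - apply Ccont_cis.
  - intros y. refine (is_CInt_ext _ _ _ _ _ _ (is_CInt_moment p q m y)).
    intros t; cbv beta. rewrite E. ring.
  - intros y. refine (is_CInt_ext _ _ _ _ _ _ (is_CInt_moment p q (S m) y)).
    intros t; cbv beta. rewrite E, S_INR.
    replace (INR q - (INR m + 1))%R with (INR q - INR m + -1)%R by ring.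
    rewrite <- cis_mult. ring.
Qed.

Lemma moment_ode (p q : nat) (z : C) : (0 < p)%nat -> (0 < q)%nat ->
  moment p q (p + q) z - z * moment p q (S q) z - moment p q 0 z = 0.
Proof.
  intros Hp Hq.
  assert (Hp0 : RtoC (INR p) <> 0).
  { intros H. apply RtoC_inj in H. revert H. apply not_0_INR. lia. }
  assert (Hq0 : RtoC (INR q) <> 0).
  { intros H. apply RtoC_inj in H. revert H. apply not_0_INR. lia. }
  pose (E := fun t => Cexp (expo p q z t)).
  (* The three powers [w^{-p}], [w^{-1}], [w^q] are [w^{q-m}] for [m = p + q], [q + 1] and [0], the
     indices in the equation. *)
  pose (E' := fun t => Ci * (cis (- INR p) t - z * cis (-1) t - cis (INR q) t) * E t).
  assert (HE : derive_re_im E E').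
  { refine (derive_re_im_ext _ _ _ _ _ _ (derive_re_im_Cexp _ _
      (derive_re_im_plus _ _ _ _ (derive_re_im_plus _ _ _ _
        (derive_re_im_scal z _ _ (derive_re_im_cis (-1)))
        (derive_re_im_scal (- / INR p) _ _ (derive_re_im_cis (- INR p))))
        (derive_re_im_scal (- / INR q) _ _ (derive_re_im_cis (INR q)))))).
    - intros t. unfold E, expo. cbv beta. f_equal. ring.
    - intros t. unfold E', E. cbv beta. f_equal.
      + rewrite !RtoC_opp. field; auto.
      + f_equal. unfold expo. ring. }
  assert (HC : Ccont E').
  { refine (Ccont_mult _ _ (Ccont_mult _ _ (Ccont_const Ci)
      (Ccont_minus _ _ (Ccont_minus _ _ (Ccont_cis _) _) (Ccont_cis _)))
      (Ccont_Cexp _ (Ccont_expo p q z))).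
    exact (Ccont_mult _ _ (Ccont_const z) (Ccont_cis _)). }
  pose proof (is_CInt_derive E E' 0 (2 * PI) HE HC) as H0.
  pose proof (is_CInt_Cmult Ci _ _ _ _ (is_CInt_minus _ _ _ _ _ _ (is_CInt_minus _ _ _ _ _ _
    (is_CInt_moment p q (p + q) z) (is_CInt_Cmult z _ _ _ _ (is_CInt_moment p q (S q) z)))
    (is_CInt_moment p q 0 z))) as H1.
  apply (is_CInt_ext _ E') in H1.
  - pose proof (is_CInt_unique _ _ _ _ _ H1 H0) as H2.
    (* All exponents in [expo] are integers, so [E] returns to its initial value after one turn. *)
    replace (E (2 * PI)%R - E 0%R) with (Ci * 0) in H2.
    2:{ unfold E, expo. rewrite !cis_0_r, cis_2PI, cis_opp_2PI.
        assert (H3 : cis (-1) (2 * PI) = 1).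
        { replace (-1)%R with (- INR 1)%R by (simpl; ring). apply cis_opp_2PI. }
        rewrite H3. ring. }
    transitivity (/ Ci * (Ci * (moment p q (p + q) z - z * moment p q (S q) z - moment p q 0 z))).
    + field. exact Ci_neq_0.
    + rewrite H2. ring.
  - intros t. unfold E', E. cbv beta.
    rewrite plus_INR, S_INR.
    replace (INR q - (INR p + INR q))%R with (- INR p)%R by ring.
    replace (INR q - (INR q + 1))%R with (-1)%R by ring.
    replace (INR q - INR 0)%R with (INR q) by (simpl; ring). ring.
Qed.

Lemma moment_nonzero (p q : nat) : (0 < p)%nat -> (0 < q)%nat ->
  ~ (forall m, moment p q m 0 = 0).
Proof.
  intros Hp Hq H.
  (* The extra factor is expanded in powers of [w^{-p}/p]. Its [j]-th term involves [w^{-pj}], hence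
     the moment of index [q + p * j], zero by assumption. *)
  assert (Z : is_CInt (fun t => Cexp (expo p q 0 t) * Cexp (/ INR p * cis (- INR p) t))
    0 (2 * PI) (RtoC 0)).
  { assert (M : forall j, is_CInt (fun t => Cexp (expo p q 0 t) * (/ INR p * cis (- INR p) t) ^ j)
      0 (2 * PI) (RtoC 0)).
    { intros j.
      pose proof (is_CInt_Cmult ((/ INR p) ^ j) _ _ _ _ (is_CInt_moment p q (q + p * j) 0)) as I.
      rewrite H, Cmult_0_r in I. refine (is_CInt_ext _ _ _ _ _ _ I).
      intros t; cbv beta. rewrite Cpow_mult_l, cis_pow.
      replace (INR q - INR (q + p * j))%R with (- INR p * INR j)%R
        by (rewrite plus_INR, mult_INR; ring).
      ring. }
    apply is_CInt_mult_Cexp.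
    - exact two_PI_ge_0.
    - apply Ccont_Cexp, Ccont_expo.
    - exact (Ccont_mult _ _ (Ccont_const _) (Ccont_cis _)).
    - refine (is_CInt_ext _ _ _ _ _ _ (M O)). intros t; simpl; ring.
    - intros j; apply M. }
  (* The remaining exponential is expanded in powers of [w^q]: the constant term integrates to
     [2 PI], every positive power to 0. *)
  assert (T : is_CInt (fun t => 1 * Cexp (- / INR q * cis (INR q) t)) 0 (2 * PI) (RtoC (2 * PI))).
  { apply is_CInt_mult_Cexp.
    - exact two_PI_ge_0.
    - apply Ccont_const.
    - exact (Ccont_mult _ _ (Ccont_const _) (Ccont_cis _)).
    - pose proof (is_CInt_derive _ _ 0 (2 * PI) derive_re_im_id (Ccont_const 1)) as I.
      replace (RtoC (2 * PI)) with (RtoC (2 * PI) - 0) by ring. exact I.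
    - intros j. destruct q as [|q]; [lia|].
      pose proof (is_CInt_Cmult ((- / INR (S q)) ^ S j) _ _ _ _
        (is_CInt_cis_period (q + S q * j))) as I.
      rewrite Cmult_0_r in I. refine (is_CInt_ext _ _ _ _ _ _ I).
      intros t; cbv beta. rewrite Cpow_mult_l, cis_pow, <- mult_INR.
      replace (S (q + S q * j)) with (S q * S j)%nat by lia. ring. }
  (* At [z = 0] the terms in [w^{-p}] cancel, so both computations concern the same integrand and
     force [2 PI = 0]. *)
  apply (is_CInt_ext _ (fun t => 1 * Cexp (- / INR q * cis (INR q) t))) in Z.
  - pose proof (is_CInt_unique _ _ _ _ _ Z T) as E. apply RtoC_inj in E.
    pose proof PI_RGT_0; lra.
  - intros t; cbv beta. rewrite <- Cexp_plus, Cmult_1_l. f_equal. unfold expo. ring.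
Qed.

(** * From the moments back to [psi] *)

Lemma psi_moment (n k : nat) : (1 < k < n)%nat ->
  forall z, psi n k z = / (2 * PI) * moment (n - k + 1) (k - 1) 0 z.
Proof.
  intros Hnk z. unfold psi, circle_int.
  set (p := (n - k + 1)%nat). set (q := (k - 1)%nat).
  (* The factor [i] from [dw = i w dt] cancels the one in [1/(2 PI i)]. *)
  rewrite (@is_RInt_unique C_R_CompleteNormedModule _ _ _ (Ci * moment p q 0 z)).
  - assert (RtoC PI <> 0).
    { intros H. apply RtoC_inj in H. revert H. apply PI_neq0. }
    field. split; [assumption | exact Ci_neq_0].
  - refine (is_CInt_ext _ _ _ _ _ _ (is_CInt_Cmult Ci _ _ _ _ (is_CInt_moment p q 0 z))).
    intros t; cbv beta.
    replace (Cexp (Ci * t)) with (cis 1 t) by (unfold cis; now rewrite Cmult_1_l).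
    assert (Hp : RtoC (INR p) <> 0).
    { intros H. apply RtoC_inj in H. revert H. apply not_0_INR. lia. }
    rewrite !cis_pow, !Rmult_1_l.
    replace (1 / (INR p * cis (INR p) t)) with (/ INR p * / cis (INR p) t)
      by (field; split; [apply cis_neq_0 | assumption]).
    unfold Cdiv. rewrite !cis_inv.
    replace (- (1))%R with (-1)%R by ring.
    (* The factor [w] from [dw] raises [w^{k-2}] to [w^{k-1} = w^q]. *)
    replace (cis (INR q - INR 0) t) with (cis (INR (k - 2)) t * cis 1 t).
    + replace (z * cis (-1) t - / INR p * cis (- INR p) t - cis (INR q) t * / INR q)
        with (expo p q z t) by (unfold expo; ring).
      ring.
    + rewrite cis_mult. f_equal. unfold q.
      rewrite !minus_INR by lia. simpl. ring.
Qed.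

(** Each iterate of the total operator is evaluated through an actual derivative of a moment, so no
    default value enters. *)
Lemma C_derive_n_psi (n k m : nat) : (1 < k < n)%nat ->
  forall z, C_derive_n (psi n k) m z = / (2 * PI) * moment (n - k + 1) (k - 1) m z.
Proof.
  intros Hnk. induction m as [|m IH]; intros z; [now apply psi_moment|].
  change (C_derive (C_derive_n (psi n k) m) z = / (2 * PI) * moment (n - k + 1) (k - 1) (S m) z).
  rewrite (functional_extensionality _ _ IH).
  apply is_C_derive_unique.
  exact (is_Cderive_scal (/ (2 * PI)) _ z _
    (is_Cderive_moment _ _ m z)).
Qed.

Lemma psi_entire (n k : nat) : (1 < k < n)%nat -> entire (psi n k).
Proof.
  intros Hnk z. rewrite (functional_extensionality _ _ (psi_moment n k Hnk)).
  eexists. exact (is_Cderive_scal (/ (2 * PI)) _ z _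
    (is_Cderive_moment _ _ 0 z)).
Qed.

Lemma psi_solution (n k : nat) : (1 < k < n)%nat -> entire_solution n k (psi n k).
Proof.
  intros Hnk. split; [now apply psi_entire|]. intros z.
  rewrite !C_derive_n_psi, psi_moment by assumption.
  pose proof (moment_ode (n - k + 1) (k - 1) z ltac:(lia) ltac:(lia)) as H.
  (* The moment indices [p + q] and [q + 1] are exactly the orders [n] and [k]. *)
  replace (n - k + 1 + (k - 1))%nat with n in H by lia.
  replace (S (k - 1)) with k in H by lia.
  transitivity (/ (2 * PI) * (moment (n - k + 1) (k - 1) n z
    - z * moment (n - k + 1) (k - 1) k z - moment (n - k + 1) (k - 1) 0 z)); [ring|].
  rewrite H; ring.
Qed.

Lemma psi_neq_0 (n k : nat) : (1 < k < n)%nat -> ~ (forall z, psi n k z = 0).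
Proof.
  intros Hnk H. apply (moment_nonzero (n - k + 1) (k - 1)); [lia | lia |]. intros m.
  assert (HPI : RtoC (2 * PI) <> 0).
  { intros E. apply RtoC_inj in E. pose proof PI_RGT_0; lra. }
  assert (D : forall m z, C_derive_n (psi n k) m z = 0).
  { intros j. rewrite (functional_extensionality _ _ H).
    induction j as [|j IH]; intros z; [reflexivity|].
    change (C_derive (C_derive_n (fun _ => 0) j) z = 0).
    rewrite (functional_extensionality _ _ IH). apply is_C_derive_unique.
    exact (@is_derive_const C_AbsRing C_NormedModule (RtoC 0) z). }
  transitivity (2 * PI * (/ (2 * PI) * moment (n - k + 1) (k - 1) m 0)).
  - rewrite RtoC_mult in HPI. field. intros E; apply HPI; rewrite E; ring.
  - rewrite <- C_derive_n_psi, D by assumption. ring.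
Qed.

Theorem theorem6 :
  forall n k : nat, (1 < k < n)%nat ->
    transcendental_entire (psi n k) /\ entire_solution n k (psi n k).
Proof.
  intros n k Hnk. pose proof (psi_solution n k Hnk) as Hsol.
  split; [split|]; [now apply psi_entire | | assumption].
  intros Hpol. exact (psi_neq_0 n k Hnk (polynomial_solution_eq_0 n k _ Hnk Hsol Hpol)).
Qed.
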